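(* Let $v>1$ and $t>1$ be odd integers and let $\lambda$ be a positive integer. If there is a $(v,2;2\lambda,\frac{v-1}{2};\lambda,\lambda)$-GSEDF (in some abelian group of order $v$), then there is a $(vt,2;4\lambda,\frac{vt-1}{2};2\lambda,2\lambda)$-GSEDF (in some abelian group of order $vt$).
   Context: Let $G$ be a finite abelian group of order $v$, written additively with identity $0$. For disjoint subsets $A,B\subseteq G$, let $\Delta(A,B)$ be the multiset $\{x-y : x\in A, y\in B\}$. For positive integers $k_1,k_2,\lambda_1,\lambda_2$, a $(v,2;k_1,k_2;\lambda_1,\lambda_2)$-generalized strong external difference family (GSEDF) in $G$ is a pair $\{D_1,D_2\}$ of disjoint nonempty subsets of $G$ with $|D_1|=k_1$, $|D_2|=k_2$ such that $\Delta(D_1,D_2)$ contains every element of $G\setminus\{0\}$ exactly $\lambda_1$ times and $\Delta(D_2,D_1)$ contains every element of $G\setminus\{0\}$ exactly $\lambda_2$ times. *)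

(* Defs.v *)
From HB Require Import structures.
From mathcomp Require Import all_boot all_algebra.

Set Implicit Arguments.
Unset Strict Implicit.
Unset Printing Implicit Defensive.

Import GRing.Theory.

Local Open Scope nat_scope.

(* The multiset {x - y : x in A, y in B}, as a sequence with repetitions. *)
Definition Delta (G : finZmodType) (A B : {set G}) : seq G :=
  [seq (x - y)%R | x <- enum A, y <- enum B].

Record is_GSEDF (v k1 k2 l1 l2 : nat) (G : finZmodType) (D1 D2 : {set G}) :
    Prop := IsGSEDF {
  gsedf_order : #|G| = v;
  gsedf_l1_gt0 : 0 < l1;
  gsedf_l2_gt0 : 0 < l2;
  gsedf_disjoint : [disjoint D1 & D2];
  gsedf_nonempty1 : D1 != set0;
  gsedf_nonempty2 : D2 != set0;
  gsedf_card1 : #|D1| = k1;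
  gsedf_card2 : #|D2| = k2;
  gsedf_Delta12 : forall g : G, g != 0%R -> count_mem g (Delta D1 D2) = l1;
  gsedf_Delta21 : forall g : G, g != 0%R -> count_mem g (Delta D2 D1) = l2
}.

Definition GSEDF_exists (v k1 k2 l1 l2 : nat) : Prop :=
  exists (G : finZmodType) (D1 D2 : {set G}), is_GSEDF v k1 k2 l1 l2 D1 D2.

(* Main.v *)
Require Import Defs.
From HB Require Import structures.
From mathcomp Require Import all_boot all_algebra.
From mathcomp Require Import zify.

(** Attach to [D2] its sign function [s2], equal to -1 on [D2] and to 1 off it.
    When [#|D1| = 2 l], the pair [D1, D2] is a GSEDF with parameters
    [(v, 2; 2 l, (v - 1) / 2; l, l)] exactly when the correlation of the
    indicator of [D1] with [s2] is [2 l] times the Dirac mass at 0.  This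
    condition is stable under tensor products; the product of two sign functions
    is the sign function of a symmetric difference.  It remains to multiply the
    given family with the family [{0, -1}], [{1, 3, ..., t - 2}] of Z/t. *)

Set Implicit Arguments.
Unset Strict Implicit.

Import GRing.Theory.

Local Open Scope nat_scope.

(** For fixed [x], the only [y] with [x - y = g] is [x - g]. *)
Lemma count_Delta (G : finZmodType) (A B : {set G}) (g : G) :
  count_mem g (Delta A B) = \sum_(x in A) ((x - g)%R \in B).
Proof.
rewrite /Delta count_flatten sumnE !big_map -big_enum /=.
apply: eq_bigr => x _; rewrite count_map -(mem_enum B).
rewrite -(count_uniq_mem _ (enum_uniq B)); apply: eq_count => y /=.
by rewrite subr_eq [RHS]eq_sym subr_eq [(y + g)%R]addrC.
Qed.

Lemma count_Delta_sym (G : finZmodType) (A B : {set G}) (g : G) :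
  count_mem g (Delta B A) = count_mem (- g)%R (Delta A B).
Proof.
rewrite !count_Delta [RHS]big_mkcond [LHS]big_mkcond /=.
rewrite (reindex_inj (addrI g)) /=.
apply: eq_bigr => x _; rewrite opprK [(g + x)%R]addrC addrK.
by case: (_ \in B); case: (_ \in A).
Qed.

Local Open Scope ring_scope.

Definition sign_corr (G : finZmodType) (A B : {set G}) (g : G) : int :=
  \sum_(x in A) (-1) ^+ (x - g \in B).

Lemma sign_corr_count (G : finZmodType) (A B : {set G}) (g : G) :
  sign_corr A B g = #|A|%:Z - (count_mem g (Delta A B)).*2%:Z.
Proof.
rewrite count_Delta /sign_corr.
suff -> : (\sum_(x in A) ((x - g)%R \in B))%N.*2%:Z =
          \sum_(x in A) (x - g \in B).*2%:Z.
  have -> : #|A|%:Z = \sum_(x in A) 1 by rewrite sumr_const natz.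
  by rewrite -sumrB; apply: eq_bigr => x _; case: (_ \in B).
by rewrite -muln2 big_distrl /= -natz natr_sum; apply: eq_bigr => x _;
  rewrite muln2 natz.
Qed.

(** For each [x], [x - g] runs once over [G]. This serves to recover [#|B|] from the correlation. *)
Lemma sum_sign_corr (G : finZmodType) (A B : {set G}) :
  \sum_g sign_corr A B g = #|A|%:Z * (#|G|%:Z - #|B|.*2%:Z).
Proof.
rewrite /sign_corr exchange_big /=.
have sumB x : \sum_g (-1) ^+ (x - g \in B) = #|G|%:Z - #|B|.*2%:Z.
  rewrite (reindex_inj (subrI x)) /=.
  under eq_bigr do rewrite subKr.
  rewrite (bigID (mem B)) /=.
  rewrite (eq_bigr (fun=> -1)) => [|y ->//].
  rewrite [X in _ + X](eq_bigr (fun=> 1)) => [|y /negPf->//].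
  rewrite !sumr_const -(cardC B).
  by rewrite mulNrn !natz; move: #|[predC B]| #|_| => c b; lia.
by rewrite (eq_bigr _ (fun x _ => sumB x)) sumr_const -mulr_natl natz.
Qed.

Lemma GSEDF_sign_corr (G : finZmodType) (D1 D2 : {set G}) (v k l : nat) :
  is_GSEDF v (2 * l) k l l D1 D2 ->
  forall g, sign_corr D1 D2 g = (g == 0)%:Z * (2 * l)%N%:Z.
Proof.
case=> _ _ _ dis _ _ c1 _ d12 _ g; rewrite sign_corr_count c1.
have [->|g0] := eqVneq g 0; last by rewrite d12 //; lia.
rewrite count_Delta big1 => [|x xD1]; first by lia.
by rewrite subr0 (disjointFr dis xD1).
Qed.

Lemma sign_corr_GSEDF (G : finZmodType) (D1 D2 : {set G}) (v l : nat) :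
  #|G| = v -> (1 < v)%N -> (0 < l)%N -> #|D1| = (2 * l)%N ->
  (forall g, sign_corr D1 D2 g = (g == 0)%:Z * (2 * l)%N%:Z) ->
  is_GSEDF v (2 * l) ((v - 1) %/ 2) l l D1 D2.
Proof.
move=> <- G1 l0 c1 corr.
have cnt g : count_mem g (Delta D1 D2) = if g == 0 then 0%N else l.
  by have := corr g; rewrite sign_corr_count c1; case: (g == 0); lia.
(* Summing the correlation over [G] gives [2 l = 2 l (#|G| - 2 #|D2|)], and [l > 0] cancels. *)
have cG : #|G| = (#|D2|.*2).+1.
  have := sum_sign_corr D1 D2.
  rewrite (bigD1 0) //= big1 => [|g /negPf g0]; last by rewrite corr g0 mul0r.
  rewrite corr eqxx c1; nia.
split=> //.
(* A common element would contribute the difference 0, whose count is 0. *)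
- rewrite -setI_eq0; apply/eqP/setP => x; rewrite !inE; apply/negP.
  case/andP=> x1 x2; have /eqP := cnt 0; rewrite eqxx count_Delta.
  by rewrite sum_nat_eq0 => /forall_inP/(_ x x1); rewrite subr0 x2.
- by rewrite -card_gt0; lia.
- by rewrite -card_gt0; lia.
- lia.
- by move=> g /negPf g0; rewrite cnt g0.
- by move=> g g0; rewrite count_Delta_sym cnt oppr_eq0 (negPf g0).
Qed.

HB.instance Definition _ (G H : finZmodType) := Finite.on (G * H)%type.

(** The correlation is multiplicative since the sign of an exclusive or is the product of the signs.
    The size of the second set then follows from the correlation. *)
Lemma GSEDF_prod (G H : finZmodType) (A B : {set G}) (C D : {set H})
    (v w k m a c : nat) :
  (1 < v)%N -> (1 < w)%N ->
  is_GSEDF v (2 * a) k a a A B -> is_GSEDF w (2 * c) m c c C D ->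
  is_GSEDF (v * w) (2 * (2 * a * c)) ((v * w - 1) %/ 2) (2 * a * c) (2 * a * c)
    (setX A C) [set p : G * H | (p.1 \in B) (+) (p.2 \in D)].
Proof.
move=> v1 w1 gAB gCD.
apply: sign_corr_GSEDF.
- by rewrite card_prod (gsedf_order gAB) (gsedf_order gCD).
- nia.
- by have := gsedf_l1_gt0 gAB; have := gsedf_l1_gt0 gCD; nia.
- by rewrite cardsX (gsedf_card1 gAB) (gsedf_card1 gCD); lia.
case=> g h.
transitivity (sign_corr A B g * sign_corr C D h).
  rewrite /sign_corr big_distrlr pair_big_dep /=.
  apply: eq_big => [[x y]|[x y] _]; first by rewrite !inE.
  by rewrite inE /= signr_addb.
rewrite (GSEDF_sign_corr gAB) (GSEDF_sign_corr gCD).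
rewrite -[(g, h) == 0]/((g == 0) && (h == 0)).
by case: (g == 0); case: (h == 0); lia.
Qed.

(** Cyclically consecutive residues have opposite parity, except [t - 1] and 0, both even as [t] is
    odd. So the signs at [- h] and [- h - 1] cancel unless [h = 0]. *)
Lemma Zp_GSEDF (t : nat) : (1 < t)%N -> odd t ->
  is_GSEDF t (2 * 1) ((t - 1) %/ 2) 1 1
    [set 0; -1 : 'Z_t] [set y : 'Z_t | odd y].
Proof.
(* ['Z_t] has order [t] only when [t > 1]; the form [n.+2] makes this definitional. *)
case: t => [|[|n]] // _ n_odd.
have N1 : (0 : 'Z_n.+2) != -1 by rewrite eq_sym oppr_eq0 oner_eq0.
apply: sign_corr_GSEDF => // [||h]; rewrite ?card_ord //.
  by rewrite cards2 N1.
have valN1 : val (-1 : 'Z_n.+2) = n.+1.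
  by rewrite /= (modn_small (m := 1)) // subSS subn0 modn_small.
have odd_pred (y : 'Z_n.+2) : odd (y - 1)%R = (y != 0) && ~~ odd y.
  have -> : nat_of_ord (y - 1) = ((y + n.+1) %% n.+2)%N.
    by rewrite -[X in (_ + X)%N]valN1.
  rewrite -[y == 0]/(val y == 0%N).
  case: y => [[|y] lt_y] /=.
    by rewrite modn_small //; move: n_odd => /=; lia.
  by rewrite addSnnS modnDr modn_small 1?ltnW // negbK.
rewrite /sign_corr big_setU1 ?inE // big_set1 !inE sub0r [-1 - h]addrC.
rewrite odd_pred -[h == 0]oppr_eq0; move: (- h) => y.
have [->|_] := eqVneq y 0 => //.
by case: (odd y).
Qed.

Unset Implicit Arguments.
Set Strict Implicit.

Local Open Scope nat_scope.

Theorem mainTheorem4 (v t lambda : nat)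
  (v_gt1 : 1 < v) (v_odd : odd v) (t_gt1 : 1 < t) (t_odd : odd t)
  (lambda_gt0 : 0 < lambda) :
  GSEDF_exists v (2 * lambda) ((v - 1) %/ 2) lambda lambda ->
  GSEDF_exists (v * t) (4 * lambda) ((v * t - 1) %/ 2) (2 * lambda) (2 * lambda).
Proof.
case=> G [D1 [D2 gD]].
have := GSEDF_prod v_gt1 t_gt1 gD (Zp_GSEDF t_gt1 t_odd).
(* The family in ['Z_t] has [c = 1]; [2 * 2 * lambda] is [4 * lambda] by computation. *)
rewrite muln1 mulnA => gP.
by exists (G * 'Z_t)%type, (setX D1 [set 0; -1])%R,
  [set p : G * 'Z_t | (p.1 \in D2) (+) (p.2 \in [set y : 'Z_t | odd y])].
Qed.
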